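(* Let $x_1,x_2,\ldots,y_1,y_2,\ldots$ be indeterminates. For every positive integer $n$, the identity $$\sum_{k=1}^{n}(-1)^{k-1}\frac{y_k}{x_k}=\cfrac{a_1}{b_1+\cfrac{a_2}{b_2+\cdots+\cfrac{a_n}{b_n}}}$$ holds in the field of rational functions over $\mathbb{Q}$ in these indeterminates, where $a_1=y_1$, $b_1=x_1$, and $$a_k=\theta y_{k-1}\cdot\theta x_{k-2},\qquad b_k=\theta x_{k-1}-\theta y_{k-1}\qquad(2\le k\le n).$$
   Context: For a sequence $(u_k)_{k\ge 1}$ of indeterminates, set $u_0=1$ (so $x_0=y_0=1$) and define $\theta u_k=\dfrac{u_{k+1}}{u_k}$ for $k\ge 0$. *)

(* Defs.v *)
From HB Require Import structures.
From mathcomp Require Import all_boot all_order all_algebra.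
From mathcomp Require Import finmap.
From mathcomp Require Import monalg.

Set Implicit Arguments.
Unset Strict Implicit.
Unset Printing Implicit Defensive.

Import GRing.Theory.
Local Open Scope ring_scope.

(* [{malg R[{cmonom I}]}] is the ring of polynomials over R in a possibly
   infinite family of indeterminates indexed by I.  The library only makes it a
   commutative ring; below it is shown to be an integral domain when R is one
   and I is countable, by Kronecker substitution into {poly R}. *)
Section MalgIdomain.
Variables (I : countType) (R : idomainType).

Local Notation mon := (cmonom I).
Local Notation "1" := (@mone mon) : monom_scope.
Local Notation malgI := {malg R[cmonom I]}.

Section Kronecker.
Variables (B N : nat).

Definition kdigit (m : mon) (j : nat) : nat := oapp m 0%N (pickle_inv j).

Definition kweight (m : mon) : nat := (\sum_(j < N) kdigit m j * B ^ j)%N.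

Definition kmon (m : mon) : {poly R} := 'X^(kweight m).

Lemma kmon_mmorphism : mmorphism kmon.
Proof.
split=> [m1 m2|]; rewrite /kmon /kweight.
  rewrite -exprD -big_split /=; congr ('X^_); apply: eq_bigr => j _.
  by rewrite /kdigit; case: (pickle_inv j) => //= i; rewrite cmM mulnDl.
rewrite big1 ?expr0 // => j _.
by rewrite /kdigit; case: (pickle_inv j) => //= i; rewrite cm1.
Qed.

HB.instance Definition _ := isMultiplicative.Build mon {poly R} kmon
  kmon_mmorphism.

Definition kpoly (p : malgI) : {poly R} := mmap (@polyC R) kmon p.

Lemma kpolyM p q : kpoly (p * q) = kpoly p * kpoly q.
Proof. exact: (rmorphM (mmap (@polyC R) kmon)). Qed.

Lemma kpoly1 : kpoly 1 = 1.
Proof. exact: (rmorph1 (mmap (@polyC R) kmon)). Qed.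

Lemma kpoly0 : kpoly 0 = 0.
Proof. exact: (raddf0 (mmap (@polyC R) kmon)). Qed.

Definition kbounded (m : mon) :=
  forall i, (m i < B)%N /\ (m i != 0%N -> (choice.pickle i < N)%N).

Lemma digits_inj n (c d : nat -> nat) :
  (forall j, (c j < B)%N) -> (forall j, (d j < B)%N) ->
  (\sum_(j < n) c j * B ^ j = \sum_(j < n) d j * B ^ j)%N ->
  forall j, (j < n)%N -> c j = d j.
Proof.
elim: n c d => [//|n IHn] c d cB dB.
have B0 : (0 < B)%N by apply: leq_ltn_trans (cB 0%N).
have split_sum (e : nat -> nat) : (\sum_(j < n.+1) e j * B ^ j =
    (\sum_(j < n) e j.+1 * B ^ j) * B + e 0)%N.
  rewrite big_ord_recl expn0 muln1 addnC big_distrl /=; congr addn.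
  by apply: eq_bigr => j _; rewrite -mulnA -expnSr.
rewrite !split_sum => E.
have E0 : c 0%N = d 0%N.
  by move/(congr1 (modn^~ B)): E; rewrite !modnMDl !modn_small.
move/(congr1 (divn^~ B)): E.
rewrite !divnMDl // !(divn_small (cB _), divn_small (dB _)) !addn0 => E.
case=> [//|j] ltjn.
by apply: (IHn (fun j => c j.+1) (fun j => d j.+1)) => // i.
Qed.

Lemma kweight_inj m1 m2 :
  kbounded m1 -> kbounded m2 -> kweight m1 = kweight m2 -> m1 = m2.
Proof.
move=> b1 b2 E; apply/eqP/cmP => i.
have B0 : (0 < B)%N by apply: leq_ltn_trans (b1 i).1.
have dB m : kbounded m -> forall j, (kdigit m j < B)%N.
  by move=> bm j; rewrite /kdigit; case: (pickle_inv j) => //= k; case: (bm k).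
have kdE m : kdigit m (choice.pickle i) = m i by rewrite /kdigit choice.pickleK_inv.
have [lti|gei] := ltnP (choice.pickle i) N.
  by rewrite -!kdE; apply: (digits_inj (dB _ b1) (dB _ b2) E).
have out m : kbounded m -> m i = 0%N.
  move=> bm; apply/eqP; apply: contraTT gei => /(bm i).2.
  by rewrite -ltnNge.
by rewrite !out.
Qed.

Lemma coef_kpoly (p : malgI) m :
  {in msupp p, forall m', kbounded m'} -> m \in msupp p ->
  (kpoly p)`_(kweight m) = p@_m.
Proof.
move=> bp mp; rewrite /kpoly mmapE coef_sum (big_fsetD1 m) //=.
rewrite coefCM coefXn eqxx mulr1 big_seq big1 ?addr0 // => m'.
rewrite in_fsetD1 => /andP[nm m'p]; rewrite coefCM coefXn.
case: eqP => [/kweight_inj E|]; last by rewrite mulr0.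
by rewrite (E (bp _ mp) (bp _ m'p)) eqxx in nm.
Qed.

Lemma kpoly_neq0 (p : malgI) :
  {in msupp p, forall m, kbounded m} -> p != 0 -> kpoly p != 0.
Proof.
move=> bp; rewrite -msupp_eq0 => /fset0Pn[m mp].
apply: contraTneq (mp) => p0.
by rewrite -mcoeff_eq0 -(coef_kpoly bp mp) p0 coef0.
Qed.

End Kronecker.

Lemma kbounds (s : seq mon) :
  exists B N, forall m, m \in s -> kbounded B N m.
Proof.
elim: s => [|m s [B [N bs]]]; first by exists 0%N, 0%N.
pose B' := (\max_(i <- finsupp m) m i).+1.
pose N' := (\max_(i <- finsupp m) (choice.pickle i)).+1.
exists (maxn B B'), (maxn N N') => m'; rewrite inE => /orP[/eqP->|/bs bm'] i.
  rewrite !leq_max !ltnS; split.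
    case: mdomP => [im|]; last by rewrite orbT.
    by rewrite (@leq_bigmax_seq _ _ _ (fun i => m i)) ?orbT.
  by rewrite cmE_neq0 => im; rewrite (@leq_bigmax_seq _ _ _ (@choice.pickle I)) ?orbT.
by have [lt1 lt2] := bm' i; split=> [|/lt2 lt3]; rewrite leq_max ?lt1 ?lt3.
Qed.

Lemma malg_idomainAxiom (p q : malgI) : p * q = 0 -> (p == 0) || (q == 0).
Proof.
apply: contra_eqT => /norP[nz_p nz_q].
have [B [N bpq]] := kbounds (msupp p ++ msupp q).
apply/eqP => /(congr1 (kpoly B N)); rewrite kpolyM kpoly0 => /eqP.
by rewrite mulf_eq0 => /orP[]; apply/negP; apply: kpoly_neq0 => // m ms;
  apply: bpq; rewrite mem_cat ms ?orbT.
Qed.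

Definition malg_unit : pred malgI :=
  fun p => (p == (p@_1%M)%:MP) && (p@_1%M \in GRing.unit).

Definition malg_inv (p : malgI) : malgI :=
  if p \in malg_unit then ((p@_1%M)^-1)%:MP else p.

Lemma malg_mulVp : {in malg_unit, left_inverse 1 malg_inv *%R}.
Proof.
move=> p Up; rewrite /malg_inv Up; case/andP: Up.
by move/eqP=> {3}-> Up; rewrite -rmorphM /= mulVr.
Qed.

Lemma malg_intro_unit (p q : malgI) : q * p = 1 -> p \in malg_unit.
Proof.
move=> qp1; apply/andP; split; last first.
  apply/unitrP; exists q@_1%M; rewrite [p@_1%M * _]mulrC.
  by rewrite -(rmorphM (mcoeff 1%M : malgI -> R)) qp1 rmorph1.
have [B [N bpq]] := kbounds (1%M :: msupp p).
have bp : {in msupp p, forall m, kbounded B N m}.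
  by move=> m mp; apply: bpq; rewrite inE mp orbT.
have := congr1 (kpoly B N) qp1; rewrite kpolyM kpoly1 => kqp1.
have : size (kpoly B N p) == 1%N.
  by move/eqP: (congr1 (size \o @polyseq R) kqp1);
    rewrite /= size_poly1 size_mul_eq1 => /andP[].
case/size_poly1P => c c0 kpE; apply/eqP/malgP => m.
rewrite mcoeffC; have [->|nm1] := eqVneq m 1%M; first by rewrite mulr1n.
rewrite mulr0n; apply/eqP; rewrite mcoeff_eq0.
apply/negP => mp; have := coef_kpoly bp mp; rewrite kpE coefC.
case: eqP => [w0 _|_ /esym/eqP]; last by rewrite mcoeff_eq0 mp.
move/eqP: nm1; apply; apply: (@kweight_inj B N) => //.
- exact: bp.
- by apply: bpq; rewrite inE eqxx.
rewrite w0 /kweight big1 // => j _.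
by rewrite /kdigit; case: (pickle_inv j) => //= i; rewrite cm1.
Qed.

Lemma malg_inv_out : {in [predC malg_unit], malg_inv =1 id}.
Proof. by rewrite /malg_inv => p /negbTE /= ->. Qed.

HB.instance Definition _ := GRing.ComRing_hasMulInverse.Build
  (malg (cmonom I) R) malg_mulVp malg_intro_unit malg_inv_out.
HB.instance Definition _ := GRing.ComUnitRing_isIntegral.Build
  (malg (cmonom I) R) malg_idomainAxiom.

End MalgIdomain.

(* Q(x_1, x_2, ..., y_1, y_2, ...): the index [inl k] stands for x_(k+1) and
   [inr k] for y_(k+1). *)
Definition ratxy : fieldType :=
  {fraction {malg rat[cmonom (nat + nat)%type]}}.

Definition indet (i : nat + nat) : ratxy :=
  FracField.tofrac (mkmalgU (ucm i) (1 : rat)).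

Definition xs (k : nat) : ratxy := if k is k'.+1 then indet (inl k') else 1.
Definition ys (k : nat) : ratxy := if k is k'.+1 then indet (inr k') else 1.

Definition theta (F : fieldType) (u : nat -> F) (k : nat) : F := u k.+1 / u k.

(* Only the values at k >= 1 are meaningful. *)
Definition cfa (k : nat) : ratxy :=
  if k == 1%N then ys 1 else theta ys (k - 1) * theta xs (k - 2).
Definition cfb (k : nat) : ratxy :=
  if k == 1%N then xs 1 else theta xs (k - 1) - theta ys (k - 1).

Section ContinuedFraction.
Variables (F : fieldType) (a b : nat -> F).

(* [cfrac k m] is the continued fraction
     a_k / (b_k + a_(k+1) / (b_(k+1) + ... + a_(k+m-1) / b_(k+m-1)))
   with m partial quotients, and [cfrac_defined k m] says that none of the
   denominators occurring in it vanishes (the inverse being total in a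
   fieldType, with 0^-1 = 0). *)
Fixpoint cfrac (k m : nat) : F :=
  if m is m'.+1 then a k / (b k + cfrac k.+1 m') else 0.

Fixpoint cfrac_defined (k m : nat) : Prop :=
  if m is m'.+1 then
    b k + cfrac k.+1 m' != 0 /\ cfrac_defined k.+1 m'
  else True.

End ContinuedFraction.

(* Main.v *)
(** Write [S_k] for the alternating sum [y_k/x_k - y_(k+1)/x_(k+1) + ...] up to
    the index [n].  Since [S_k + S_(k+1) = y_k/x_k], descending induction on [k]
    shows that the tail of the continued fraction starting at [a_k], [k >= 2],
    equals [x_(k-1) S_k / (x_(k-2) S_(k-1))]; its denominators are then
    [y_k S_(k-1) / (y_(k-1) S_k)], and [y_1/S_1] for [k = 1].  No [S_k] vanishes:
    specializing every indeterminate except [y_k] to 1, the summand [y_k/x_k]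
    can still be given any value. *)

Require Import Defs.
From HB Require Import structures.
From mathcomp Require Import all_boot all_order all_algebra.
From mathcomp Require Import ring.
From mathcomp Require Import finmap monalg.

Set Implicit Arguments.
Unset Strict Implicit.
Unset Printing Implicit Defensive.

Import GRing.Theory.
Local Open Scope ring_scope.

Definition polxy : idomainType := {malg rat[cmonom (nat + nat)%type]}.

Definition Xpol (i : nat + nat) : polxy := mkmalgU (ucm i) 1.

Section Specialization.
Variables (i : nat + nat) (t : rat).

(** The value of [m] at the point with coordinate [t] at [i] and 1 everywhere else. *)
Definition mon_spec (m : cmonom (nat + nat)%type) : rat := t ^+ m i.

Lemma mon_spec_mmorphism : mmorphism mon_spec.
Proof. by split=> [m1 m2|]; rewrite /mon_spec ?cmM ?exprD ?cm1 ?expr0. Qed.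

HB.instance Definition _ :=
  isMultiplicative.Build (cmonom (nat + nat)%type) rat mon_spec
    mon_spec_mmorphism.

Definition spec : {rmorphism polxy -> rat} := mmap (@idfun rat) mon_spec.

Lemma specX j : spec (Xpol j) = if j == i then t else 1.
Proof. by rewrite /spec /= mmapU mul1r /mon_spec ucmE; case: eqP. Qed.

End Specialization.

Section AlternatingSum.
Variables (R : pzRingType) (u : nat -> R).

Definition altsum (k m : nat) : R := \sum_(j < m) (-1) ^+ j * u (k + j)%N.

Lemma altsum0 k : altsum k 0 = 0.
Proof. by rewrite /altsum big_ord0. Qed.

Lemma altsumS k m : altsum k m.+1 = u k - altsum k.+1 m.
Proof.
rewrite /altsum big_ord_recl mul1r addn0 -sumrN; congr (_ + _).
by apply: eq_bigr => j _; rewrite exprS mulN1r mulNr addnS.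
Qed.

End AlternatingSum.

Section Specializes.
Variables (D : idomainType) (R : comNzRingType) (phi : {rmorphism D -> R}).

(** Evaluation through [phi] is only partial on fractions, hence a relation. Normalizing [phi q = 1]
    keeps division out of [R]; it suffices because every x_k is sent to 1. *)
Definition specializes (f : {fraction D}) (v : R) :=
  exists p q : D,
    [/\ phi q = 1, phi p = v & f * FracField.tofrac q = FracField.tofrac p].

Lemma specializes_neq0 f v : specializes f v -> v != 0 -> f != 0.
Proof.
move=> [p [q [_ <- fq]]]; apply: contraNneq => f0.
move/eqP: fq; rewrite f0 mul0r eq_sym tofrac_eq0 => /eqP ->.
by rewrite rmorph0.
Qed.

Lemma specializes0 : specializes 0 0.
Proof. by exists 0, 1; rewrite rmorph0 rmorph1 mul0r tofrac0. Qed.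

Lemma specializes_tofrac p : specializes (FracField.tofrac p) (phi p).
Proof. by exists p, 1; rewrite rmorph1 tofrac1 mulr1. Qed.

Lemma specializesB f g v w :
  specializes f v -> specializes g w -> specializes (f - g) (v - w).
Proof.
move=> [p [q [q1 <- fq]]] [r [s [s1 <- gs]]].
exists (p * s - r * q), (q * s); split.
- by rewrite rmorphM q1 s1 mulr1.
- by rewrite rmorphB !rmorphM q1 s1 !mulr1.
by rewrite tofracB !tofracM -fq -gs; ring.
Qed.

Lemma specializes_div (p q : D) v :
  phi p = v -> phi q = 1 ->
  specializes (FracField.tofrac p / FracField.tofrac q) v.
Proof.
move=> pv q1; exists p, q; split=> //; rewrite divfK // tofrac_eq0.
by apply: contra_eq_neq q1 => ->; rewrite rmorph0 eq_sym oner_eq0.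
Qed.

End Specializes.

Lemma indet_neq0 i : indet i != 0.
Proof.
have := specializes_tofrac (spec i 1) (Xpol i).
by rewrite specX eqxx => /specializes_neq0; apply.
Qed.

Lemma xs_neq0 k : xs k != 0.
Proof. case: k => [|k]; [exact: oner_neq0 | exact: indet_neq0]. Qed.

Lemma ys_neq0 k : ys k != 0.
Proof. case: k => [|k]; [exact: oner_neq0 | exact: indet_neq0]. Qed.

Local Notation alt := (altsum (fun k => ys k / xs k)).

Lemma altsum_spec i t k m :
  specializes (spec (inr i) t) (alt k.+1 m)
    (altsum (fun j => if j == i.+1 then t else 1) k.+1 m).
Proof.
elim: m k => [|m IHm] k; first by rewrite !altsum0; apply: specializes0.
rewrite !altsumS; apply: specializesB (IHm _).
exact: specializes_div (specX (inr i) t (inr k)) (specX (inr i) t (inl k)).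
Qed.

Lemma altsum_neq0 k m : alt k.+1 m.+1 != 0.
Proof.
(* [c] is the sum after its first term with all indeterminates set to 1. Sending [inr k], that is
   y_(k+1), to [1 + c] makes the whole sum (1 + c) - c = 1. *)
pose c : rat := altsum (fun=> 1) k.+2 m.
apply: specializes_neq0 (altsum_spec k (1 + c) k m.+1) _.
rewrite altsumS eqxx (_ : altsum _ _ _ = c) ?addrK ?oner_eq0 //.
(* The remaining indices start at [k.+2], so none of them meets the special value at [k.+1]. *)
apply: eq_bigr => j _; case: eqP => // /eqP.
by rewrite gtn_eqF // addSn ltnS ltnS leq_addr.
Qed.

Lemma altsum_shift k m : alt k.+1 m = ys k / xs k - alt k m.+1.
Proof. by rewrite altsumS subKr. Qed.

Lemma cfaE k : cfa k.+2 = ys k.+2 / ys k.+1 * (xs k.+1 / xs k).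
Proof. by rewrite /cfa /theta /= subn1 subn2. Qed.

Lemma cfbE k : cfb k.+2 = xs k.+2 / xs k.+1 - ys k.+2 / ys k.+1.
Proof. by rewrite /cfb /theta /= subn1. Qed.

Lemma denominator_identity (F : fieldType) (x0 x1 y0 y1 s : F) :
  x0 != 0 -> x1 != 0 -> y0 != 0 -> s != 0 ->
  x1 / x0 - y1 / y0 + x1 * (y1 / x1 - s) / (x0 * s) =
  y1 * (y0 / x0 - s) / (y0 * s).
Proof. by move=> *; field; apply/and4P. Qed.

Lemma quotient_identity (F : fieldType) (x0 x1 y1 y2 s r : F) :
  x0 != 0 -> y1 != 0 -> y2 != 0 -> s != 0 -> r != 0 ->
  y2 / y1 * (x1 / x0) / (y2 * r / (y1 * s)) = x1 * s / (x0 * r).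
Proof. by move=> *; field; apply/and5P. Qed.

(** The tail formula is a hypothesis, so that this serves both within the induction proving
    [cfrac_tail] and, later, for the nonvanishing of the denominators. *)
Lemma denominator_of_tail k m :
  cfrac cfa cfb k.+3 m = xs k.+2 * alt k.+3 m / (xs k.+1 * alt k.+2 m.+1) ->
  cfb k.+2 + cfrac cfa cfb k.+3 m =
  ys k.+2 * alt k.+1 m.+2 / (ys k.+1 * alt k.+2 m.+1).
Proof.
(* Both neighbouring sums are expressed through [alt k.+2 m.+1], the [s] of
   [denominator_identity]. *)
move=> ->; rewrite cfbE altsum_shift [alt k.+1 _]altsumS.
exact: denominator_identity (xs_neq0 _) (xs_neq0 _) (ys_neq0 _)
  (altsum_neq0 _ _).
Qed.

Lemma cfrac_tail k m :
  cfrac cfa cfb k.+2 m = xs k.+1 * alt k.+2 m / (xs k * alt k.+1 m.+1).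
Proof.
(* Since [k] stays general and the last index [k + m + 1] is fixed, induction on [m] is descending
   induction on the starting index. *)
elim: m k => [|m IHm] k; first by rewrite altsum0 mulr0 mul0r.
rewrite [LHS]/= (denominator_of_tail (IHm _)) cfaE.
exact: quotient_identity (xs_neq0 _) (ys_neq0 _) (ys_neq0 _)
  (altsum_neq0 _ _) (altsum_neq0 _ _).
Qed.

Lemma cfrac_defined_tail k m : cfrac_defined cfa cfb k.+2 m.
Proof.
elim: m k => [//|m IHm] k; split; last exact: IHm.
rewrite (denominator_of_tail (cfrac_tail _ _)).
by apply: mulf_neq0; [|apply: invr_neq0]; apply: mulf_neq0;
  exact: ys_neq0 || exact: altsum_neq0.
Qed.

Lemma first_denominator_identity (F : fieldType) (x y s : F) :
  x != 0 -> s != 0 -> x + x * (y / x - s) / (1 * s) = y / s.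
Proof. by move=> *; field; apply/andP. Qed.

(** Separate from the general case because b_1 has its own form; the factor 1 in the identity above
    is [xs 0]. *)
Lemma first_denominator m : cfb 1 + cfrac cfa cfb 2 m = ys 1 / alt 1 m.+1.
Proof.
rewrite cfrac_tail altsum_shift.
exact: first_denominator_identity (xs_neq0 1) (altsum_neq0 _ _).
Qed.

Theorem theorem1 (n : nat) (n_gt0 : (0 < n)%N) :
  cfrac_defined cfa cfb 1 n /\
  \sum_(1 <= k < n.+1) (-1) ^+ (k - 1) * (ys k / xs k) = cfrac cfa cfb 1 n.
Proof.
case: n n_gt0 => // m _; split.
  split; last exact: cfrac_defined_tail.
  rewrite first_denominator.
  exact: mulf_neq0 (ys_neq0 _) (invr_neq0 (altsum_neq0 _ _)).
rewrite [RHS]/= first_denominator.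
(* The fraction is y_1 / (y_1 / S_1) = S_1. *)
rewrite invf_div mulrC divfK ?ys_neq0 // big_add1 big_mkord.
by apply: eq_bigr => j _; rewrite subn1.
Qed.
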